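(* Let $\mathrm{X}_1\subset\mathbb{R}^{n_1}$ and $\mathrm{X}_2\subset\mathbb{R}^{n_2}$ be nonempty, convex, and compact. Let $J_1:\mathrm{X}_1\times\mathrm{X}_2\to\mathbb{R}$ be continuous on $\mathrm{X}_1\times\mathrm{X}_2$, and let $\mathrm{BR}_2$ be the best-response correspondence of Player 2. Suppose that: (i) there is $\mu>0$ such that for every fixed $x_2\in\mathrm{X}_2$ the function $J_1(\cdot,x_2)$ is differentiable and $\mu$-strongly convex on $\mathrm{X}_1$; (ii) there is $L_{12}\ge 0$ such that for every $x_1\in\mathrm{X}_1$ and all $x_2,y_2\in\mathrm{X}_2$, $\|\nabla_{x_1}J_1(x_1,x_2)-\nabla_{x_1}J_1(x_1,y_2)\|\le L_{12}\|x_2-y_2\|$; (iii) for every $x_1\in\mathrm{X}_1$, $\mathrm{BR}_2(x_1)$ is single-valued (a singleton), so that $\mathrm{BR}_2$ is regarded as a map $\mathrm{X}_1\to\mathrm{X}_2$; (iv) the map $\mathrm{BR}_2:\mathrm{X}_1\to\mathrm{X}_2$ is Lipschitz on $\mathrm{X}_1$ with constant $L_2\ge 0$; (v) there is a constant $L_1$ such that for every fixed $x_2\in\mathrm{X}_2$ the function $J_1(\cdot,x_2)$ is $L_1$-smooth on $\mathrm{X}_1$, i.e., for all $x_1,y_1\in\mathrm{X}_1$, $\|\nabla_{x_1}J_1(x_1,x_2)-\nabla_{x_1}J_1(y_1,x_2)\|\le L_1\|x_1-y_1\|$; (vi) $\mu>L_{12}L_2$. Let $(x_1^\star,x_2^\star)\in\mathrm{X}_1\times\mathrm{X}_2$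 denote the unique Nash equilibrium of the asymmetric-information two-player game defined by $(\mathrm{X}_1,\mathrm{X}_2,J_1,\mathrm{BR}_2)$. Let $m:=\mu-L_{12}L_2$, $L_G:=L_1+L_{12}L_2$, and choose $\alpha\in(0,2m/L_G^2)$. Let $\varepsilon>0$ and let $\widehat{\mathrm{BR}}_2:\mathrm{X}_1\to\mathrm{X}_2$ be a map satisfying $$\|\widehat{\mathrm{BR}}_2(x_1)-\mathrm{BR}_2(x_1)\|\le\varepsilon\qquad\text{for all }x_1\in\mathrm{X}_1.$$ Then the iterates generated, from any initial point $x_1^0\in\mathrm{X}_1$, by $$x_2^k=\widehat{\mathrm{BR}}_2(x_1^k),\qquad x_1^{k+1}=\Pi_{\mathrm{X}_1}\!\left(x_1^k-\alpha\nabla_{x_1}J_1(x_1^k,x_2^k)\right),\qquad k\ge 0,$$ satisfy, for all $k\ge 0$, $$\|x_1^{k+1}-x_1^\star\|\le\rho(\alpha)\|x_1^k-x_1^\star\|+\alpha L_{12}\varepsilon,\qquad\text{where }\rho(\alpha)=\sqrt{1-2\alpha m+\alpha^2L_G^2}\in(0,1).$$ Consequently, $$\limsup_{k\to\infty}\|x_1^k-x_1^\star\|\le\frac{\alpha L_{12}}{1-\rho(\alpha)}\,\varepsilon.$$ Moreover, the sequence $x_2^k=\widehat{\mathrm{BR}}_2(x_1^k)$ satisfies $$\|x_2^k-x_2^\star\|\le L_2\|x_1^k-x_1^\star\|+\varepsilon,$$ and hence $$\limsup_{k\to\infty}\|x_2^k-x_2^\star\|\le\left(L_2\frac{\alpha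 L_{12}}{1-\rho(\alpha)}+1\right)\varepsilon.$$
   Context: The asymmetric-information two-player game: Player 1 chooses $x_1\in\mathrm{X}_1$ to minimize $J_1(x_1,x_2)$ over $x_1\in\mathrm{X}_1$, while Player 2 simultaneously reacts with $x_2\in\mathrm{BR}_2(x_1)$. Here $\mathrm{BR}_2(x_1)=\arg\min_{x_2\in\mathrm{X}_2}J_2(x_1,x_2)$ for some objective $J_2$ which need not be known to Player 1; Player 2 enters only through $\mathrm{BR}_2$. The map $\widehat{\mathrm{BR}}_2$ is an approximation of $\mathrm{BR}_2$. A pair $(x_1^\star,x_2^\star)\in\mathrm{X}_1\times\mathrm{X}_2$ is a Nash equilibrium of this game if $x_1^\star\in\arg\min_{x_1\in\mathrm{X}_1}J_1(x_1,x_2^\star)$ and $x_2^\star\in\mathrm{BR}_2(x_1^\star)$. Under the compactness and convexity of the feasible sets, the continuity of $J_1$, and hypotheses (i)–(iv) and (vi), the game has exactly one Nash equilibrium. $\|\cdot\|$ is the Euclidean norm, $\nabla_{x_1}J_1(x_1,x_2)$ denotes the gradient of $J_1(\cdot,x_2)$ at $x_1$, and $\Pi_{\mathrm{X}_1}$ denotes Euclidean projection onto $\mathrm{X}_1$.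
   Formalization: The claim ρ(α)∈(0,1) is replaced by 0≤ρ(α)<1, with ρ(α)>0 asserted except when X_1 is a single point and L_1<μ, or when L_12L_2=0, L_1=μ and α=1/μ (where ρ(α)=0); all the error bounds are kept in full. *)

(* Defs.v *)
From HB Require Import structures.
From mathcomp Require Import all_boot all_order all_algebra.
From mathcomp Require Import all_classical all_reals all_analysis.

Set Implicit Arguments.
Unset Strict Implicit.
Unset Printing Implicit Defensive.
Import Order.TTheory GRing.Theory Num.Theory.
Import numFieldNormedType.Exports.
Local Open Scope classical_set_scope.
Local Open Scope ring_scope.

(* The library norm `|x| on 'rV[R]_n is the sup norm, so the Euclidean one is
   introduced separately; both induce the library topology on 'rV[R]_n. *)
Definition edot (R : realType) (n : nat) (x y : 'rV[R]_n) : R :=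
  \sum_(i < n) x ord0 i * y ord0 i.

Definition enorm (R : realType) (n : nat) (x : 'rV[R]_n) : R :=
  Num.sqrt (edot x x).

Definition argmin (R : realType) (T : Type) (X : set T) (f : T -> R) : set T :=
  [set x | X x /\ forall y, X y -> f x <= f y].

(* Euclidean projection: a nearest point of X, chosen by [get]. It exists and
   is unique when X is nonempty, closed and convex; otherwise the value of
   [get] may be arbitrary. *)
Definition eproj (R : realType) (n : nat) (X : set 'rV[R]_n) (z : 'rV[R]_n) :
    'rV[R]_n :=
  get (argmin X (fun y => enorm (z - y))).

(* g is a gradient at x of f restricted to X:
   f y = f x + <g, y - x> + o(||y - x||) as y tends to x inside X.
   Only the values of f on X matter. At a point of the interior of X this is
   the usual gradient, and the gradient of any differentiable extension of f
   qualifies. If X has empty interior, g need not be unique. *)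
Definition is_gradient (R : realType) (n : nat) (X : set 'rV[R]_n)
    (f : 'rV[R]_n -> R) (x g : 'rV[R]_n) : Prop :=
  forall e : R, 0 < e ->
    \forall y \near within X (nbhs x),
      `|f y - f x - edot g (y - x)| <= e * enorm (y - x).

Definition strongly_convex (R : realType) (n : nat) (X : set 'rV[R]_n)
    (mu : R) (f : 'rV[R]_n -> R) : Prop :=
  forall (x y : 'rV[R]_n) (t : R), X x -> X y -> 0 <= t <= 1 ->
    f (t *: x + (1 - t) *: y) <=
      t * f x + (1 - t) * f y - mu / 2 * t * (1 - t) * enorm (x - y) ^+ 2.

Definition elipschitz (R : realType) (n p : nat) (X : set 'rV[R]_n)
    (L : R) (f : 'rV[R]_n -> 'rV[R]_p) : Prop :=
  forall x y, X x -> X y -> enorm (f x - f y) <= L * enorm (x - y).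

Definition best_response (R : realType) (n1 n2 : nat) (X2 : set 'rV[R]_n2)
    (J2 : 'rV[R]_n1 -> 'rV[R]_n2 -> R) (x1 : 'rV[R]_n1) : set 'rV[R]_n2 :=
  argmin X2 (J2 x1).

Definition nash_equilibrium (R : realType) (n1 n2 : nat)
    (X1 : set 'rV[R]_n1) (X2 : set 'rV[R]_n2)
    (J1 : 'rV[R]_n1 -> 'rV[R]_n2 -> R) (BR2 : 'rV[R]_n1 -> set 'rV[R]_n2)
    (x1 : 'rV[R]_n1) (x2 : 'rV[R]_n2) : Prop :=
  [/\ X1 x1, X2 x2, argmin X1 (fun y1 => J1 y1 x2) x1 & BR2 x1 x2].

(* Main.v *)
(* Write G x = gradJ1 x (br2 x). It is (mu - L12 L2)-strongly monotone and
   (L1 + L12 L2)-Lipschitz on X1, so an exact forward step x - alpha G x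
   contracts distances by rho, and replacing br2 by hbr2 perturbs it by at most
   alpha L12 eps. The first-order optimality of x1s makes it a fixed point of
   the exact projected step; the comparison of the two projected points uses
   only their obtuse-angle conditions, never uniqueness of the projection. *)
Require Import Defs.
From HB Require Import structures.
From mathcomp Require Import all_boot all_order all_algebra.
From mathcomp Require Import all_classical all_reals all_analysis.
From mathcomp Require Import ring lra.

Set Implicit Arguments.
Unset Strict Implicit.
Unset Printing Implicit Defensive.
Import Order.TTheory GRing.Theory Num.Theory.
Import numFieldNormedType.Exports.
Local Open Scope classical_set_scope.
Local Open Scope ring_scope.

(** * Euclidean inner product and norm *)

Section EuclideanSpace.
Variables (R : realType) (n : nat).
Implicit Types (x y z : 'rV[R]_n) (t : R).

Lemma edotC x y : edot x y = edot y x.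
Proof. by apply: eq_bigr => i _; rewrite mulrC. Qed.

Lemma edotDl x y z : edot (x + y) z = edot x z + edot y z.
Proof. by rewrite -big_split; apply: eq_bigr => i _; rewrite mxE mulrDl. Qed.

Lemma edotZl t x y : edot (t *: x) y = t * edot x y.
Proof. by rewrite mulr_sumr; apply: eq_bigr => i _; rewrite mxE mulrA. Qed.

Lemma edotNl x y : edot (- x) y = - edot x y.
Proof. by rewrite -scaleN1r edotZl mulN1r. Qed.

Lemma edotDr x y z : edot x (y + z) = edot x y + edot x z.
Proof. by rewrite !(edotC x) edotDl. Qed.

Lemma edotZr t x y : edot x (t *: y) = t * edot x y.
Proof. by rewrite !(edotC x) edotZl. Qed.

Lemma edotNr x y : edot x (- y) = - edot x y.
Proof. by rewrite !(edotC x) edotNl. Qed.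

Lemma edot0l x : edot 0 x = 0.
Proof. by rewrite -(scale0r x) edotZl mul0r. Qed.

Lemma edot0r x : edot x 0 = 0.
Proof. by rewrite edotC edot0l. Qed.

Definition edotE := (edotDl, edotDr, edotNl, edotNr, edotZl, edotZr).

Lemma edot_ge0 x : 0 <= edot x x.
Proof. by apply: sumr_ge0 => i _; rewrite -expr2 sqr_ge0. Qed.

Lemma edot_eq0 x : (edot x x == 0) = (x == 0).
Proof.
apply/eqP/eqP => [xx0|->]; last by rewrite edot0l.
apply/rowP => i; rewrite mxE; apply/eqP; rewrite -sqrf_eq0 expr2; apply/eqP.
by apply: (psumr_eq0P (F := fun i => x ord0 i * x ord0 i)) xx0 _ _ => // j _;
  rewrite -expr2 sqr_ge0.
Qed.

Lemma enorm_ge0 x : 0 <= enorm x.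
Proof. exact: sqrtr_ge0. Qed.

Lemma enorm_sqr x : enorm x ^+ 2 = edot x x.
Proof. by rewrite sqr_sqrtr ?edot_ge0. Qed.

Lemma enorm_eq0 x : (enorm x == 0) = (x == 0).
Proof. by rewrite -edot_eq0 -enorm_sqr sqrf_eq0. Qed.

Lemma enormZ t x : 0 <= t -> enorm (t *: x) = t * enorm x.
Proof.
move=> t0; rewrite /enorm edotZl edotZr mulrA sqrtrM ?mulr_ge0//.
by rewrite -expr2 sqrtr_sqr ger0_norm.
Qed.

Lemma enormN x : enorm (- x) = enorm x.
Proof. by rewrite /enorm edotNl edotNr opprK. Qed.

Lemma enormB x y : enorm (x - y) = enorm (y - x).
Proof. by rewrite -enormN opprB. Qed.

Lemma enorm_le x y : edot x x <= edot y y -> enorm x <= enorm y.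
Proof. exact: ler_wsqrtr. Qed.

Lemma edot_le x y : edot x y <= enorm x * enorm y.
Proof.
have [/eqP|xy0] := eqVneq (enorm x * enorm y) 0.
  by rewrite mulf_eq0 !enorm_eq0 => /orP[]/eqP->;
    rewrite ?edot0l ?edot0r mulr_ge0 ?enorm_ge0.
have {}xy0 : 0 < enorm x * enorm y.
  by rewrite lt_neqAle eq_sym xy0 mulr_ge0 ?enorm_ge0.
(* Expanding the square gives [2 * N * (N - edot x y)] with [N = enorm x * enorm y], and [N > 0] can
   be divided out. *)
have := edot_ge0 (enorm y *: x - enorm x *: y).
rewrite !edotE (edotC y x) -!enorm_sqr => h.
rewrite -subr_ge0 -(pmulr_rge0 _ xy0); nra.
Qed.

Lemma enormD x y : enorm (x + y) <= enorm x + enorm y.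
Proof.
rewrite -(@ler_pXn2r _ 2) ?nnegrE ?addr_ge0 ?enorm_ge0// enorm_sqr.
rewrite !edotE (edotC y x) -!enorm_sqr.
by have := edot_le x y; lra.
Qed.

Lemma enorm_continuous : continuous (@enorm R n).
Proof.
move=> x; apply: (@continuous_comp _ _ _ (fun y => edot y y)); last first.
  exact: sqrt_continuous.
have F : Filter (nbhs x) by exact: nbhs_filter.
apply: (@cvg_big R _ _ _ _ _ _ (nbhs x)) => [p|i _].
  by apply: cvgD; [exact: cvg_fst|exact: cvg_snd].
by apply: (@cvgM R _ (nbhs x) F); exact: coord_continuous.
Qed.

End EuclideanSpace.

(** * First-order conditions and projection on a convex set *)

Section ConvexMinimization.
Variables (R : realType) (n : nat) (X : set 'rV[R]_n).
Hypothesis X_convex : convex_set X.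
Implicit Types (x y z g : 'rV[R]_n) (t : R) (f : 'rV[R]_n -> R).

(** Allows a plain real weight where [convex_set] asks for a bundled element of the unit
    interval. *)
Lemma convex_set_segment x y t :
  X x -> X y -> 0 <= t <= 1 -> X (t *: y + (1 - t) *: x).
Proof.
move=> Xx Xy /andP[t0 t1].
have t01 : Itv.spec (@Itv.num_sem R) (Itv.Real `[0%Z, 1%Z]) t.
  by rewrite /Itv.spec/= /Itv.num_sem/= ger0_real//= in_itv/= t0 t1.
have := X_convex (Itv.mk t01) (mem_set Xy) (mem_set Xx).
by rewrite inE.
Qed.

(** The little-o condition is needed only along a segment, at one small weight. The bound [t <= e]
    serves to absorb terms of second order in [t]. *)
Lemma is_gradient_segment f x y g e :
  is_gradient X f x g -> X x -> X y -> 0 < e ->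
  exists t, [/\ 0 < t, t <= 1, t <= e &
    `|f (t *: y + (1 - t) *: x) - f x - t * edot g (y - x)| <= t * e].
Proof.
move=> fg Xx Xy e0.
have d0 : 0 < enorm (y - x) + 1 by rewrite ltr_wpDl ?enorm_ge0.
have segE t : t *: y + (1 - t) *: x = x + t *: (y - x).
  by rewrite scalerBr scalerBl scale1r addrCA.
(* The [+ 1] keeps the divisor positive when [y = x]; at distance [t * enorm (y - x)] this tolerance
   gives an error of at most [t * e]. *)
have /fg : 0 < e / (enorm (y - x) + 1) by rewrite divr_gt0.
rewrite near_withinE => near_x.
have seg_cvg : x + t *: (y - x) @[t --> (0 : R)] --> x.
  rewrite -[X in _ --> X]addr0 -[in X in _ --> X](scale0r (y - x)).
  by apply: cvgD; [exact: cvg_cst|exact: scalel_continuous].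
have /nbhs_ballP[r /= r0 near0] := seg_cvg _ near_x.
pose t := Num.min (r / 2) (Num.min 1 e).
have t0 : 0 < t by rewrite !lt_min divr_gt0//= ltr01.
have t1 : t <= 1 by rewrite !ge_min lexx orbT.
exists t; split => //; first by rewrite !ge_min lexx !orbT.
have tr : ball (0 : R) r t.
  rewrite -ball_normE /= sub0r normrN gtr0_norm// gt_min.
  by rewrite ltr_pdivrMr// ltr_pMr// ltr1n.
have t01 : 0 <= t <= 1 by rewrite ltW.
have := near0 t tr; rewrite /= -segE => /(_ (convex_set_segment Xx Xy t01)).
rewrite segE addrAC [x + _]addrC addrK edotZr enormZ ?(ltW t0)//.
rewrite [_ - _ - f x]addrAC => /le_trans; apply.
rewrite mulrCA ler_pM2l// mulrAC ler_pdivrMr// ler_pM2l//.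
by rewrite lerDl.
Qed.

(** At a minimizer the difference quotients toward [y] are nonnegative, and for small [t] they come
    within any [e] of [edot g (y - x)]. *)
Lemma argmin_edot_ge0 f x y g :
  is_gradient X f x g -> argmin X f x -> X y -> 0 <= edot g (y - x).
Proof.
move=> fg [Xx fx] Xy; apply/ler_addgt0Pr => e e0.
have [t [t0 t1 _]] := is_gradient_segment fg Xx Xy e0.
have t01 : 0 <= t <= 1 by rewrite ltW.
rewrite ler_norml => /andP[_ fgt].
have := fx _ (convex_set_segment Xx Xy t01).
by rewrite -(pmulr_rge0 _ t0); lra.
Qed.

Lemma strongly_convex_gradient f mu x y g : 0 < mu ->
  strongly_convex X mu f -> is_gradient X f x g -> X x -> X y ->
  edot g (y - x) + mu / 2 * enorm (y - x) ^+ 2 <= f y - f x.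
Proof.
move=> mu0 fmu fg Xx Xy; apply/ler_addgt0Pr => e e0.
set N := enorm (y - x) ^+ 2.
have N0 : 0 < mu / 2 * N + 1.
  by rewrite ltr_wpDl// mulr_ge0 ?sqr_ge0// divr_ge0// ltW.
(* After division by [t], strong convexity carries the factor [1 - t]. Its defect [t * (mu / 2 * N)]
   and the gradient error share [e]: this quotient bounds both [t] and the gradient error. *)
have e'0 : 0 < e / (mu / 2 * N + 1) by rewrite divr_gt0.
have [t [t0 t1 te]] := is_gradient_segment fg Xx Xy e'0.
rewrite ler_norml => /andP[fgt _].
have t01 : 0 <= t <= 1 by rewrite ltW.
have := fmu y x t Xy Xx t01; rewrite -/N => fsc.
have eE : e = (mu / 2 * N + 1) * (e / (mu / 2 * N + 1)).
  by rewrite mulrC divfK ?gt_eqF.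
move: (e / _) eE te fgt {e'0} => e' eE te fgt.
have h : 0 <= t * (mu / 2 * N) * (e' - t).
  rewrite mulr_ge0 ?subr_ge0//.
  by rewrite mulr_ge0 ?(ltW t0)// mulr_ge0 ?sqr_ge0// divr_ge0// ltW.
by rewrite eE -(ler_pM2l t0); lra.
Qed.

(** In the sum of the first-order lower bounds at [x] and at [y], the function values cancel and the
    two halves of [mu] add up. *)
Lemma strongly_convex_monotone f mu x y gx gy : 0 < mu ->
  strongly_convex X mu f -> is_gradient X f x gx -> is_gradient X f y gy ->
  X x -> X y -> mu * enorm (x - y) ^+ 2 <= edot (gx - gy) (x - y).
Proof.
move=> mu0 fmu fx fy Xx Xy.
have := strongly_convex_gradient mu0 fmu fx Xx Xy.
have := strongly_convex_gradient mu0 fmu fy Xy Xx.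
by rewrite (enormB y x) !edotE; lra.
Qed.

Hypotheses (X_neq0 : X !=set0) (X_compact : compact X).

(** The extreme value theorem supplies a nearest point, so [get] returns one instead of its
    default. *)
Lemma eproj_argmin z : argmin X (fun y => enorm (z - y)) (eproj X z).
Proof.
have [|p] := @EVT_min_rV R n (fun y => enorm (z - y)) X X_neq0 X_compact.
  apply: continuous_subspaceT => y.
  apply: (@continuous_comp _ _ _ (fun y => z - y)).
    apply: (@continuousB R 'rV[R]_n 'rV[R]_n (fun=> z) id) => //.
    exact: cst_continuous.
  exact: enorm_continuous.
rewrite inE => Xp minp.
have : argmin X (fun y => enorm (z - y)) !=set0.
  by exists p; split => // y Xy; apply: minp; rewrite inE.
exact: getPex.
Qed.

Lemma eproj_in z : X (eproj X z).
Proof. by have [] := eproj_argmin z. Qed.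

(** Moving from the projection toward [y] cannot shorten the distance to [z]; for small [t] the
    linear term of the expanded square decides the sign. *)
Lemma eproj_obtuse z y : X y -> edot (z - eproj X z) (y - eproj X z) <= 0.
Proof.
move=> Xy; have [] := eproj_argmin z; set p := eproj X z => Xp minp.
apply/ler_addgt0Pr => e e0; rewrite add0r.
set N := edot (y - p) (y - p).
have N0 : 0 < N + 1 by rewrite ltr_wpDl ?edot_ge0.
pose t := Num.min 1 (e / (N + 1)).
have t0 : 0 < t by rewrite lt_min ltr01 divr_gt0.
have t1 : t <= 1 by rewrite ge_min lexx.
have tN : t * N <= e.
  have : t <= e / (N + 1) by rewrite ge_min lexx orbT.
  by rewrite ler_pdivlMr// => /(le_trans _); apply; nra.
have t01 : 0 <= t <= 1 by rewrite ltW.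
have := minp _ (convex_set_segment Xp Xy t01).
have -> : z - (t *: y + (1 - t) *: p) = (z - p) - t *: (y - p).
  by apply/rowP => i; rewrite !mxE; ring.
rewrite -(@ler_pXn2r _ 2) ?nnegrE ?enorm_ge0// !enorm_sqr.
move: tN; rewrite /N; move: (y - p) (z - p) => d w tN.
rewrite !edotE (edotC d w) => h.
have : 0 <= t * (t * edot d d - 2 * edot w d) by lra.
by rewrite (pmulr_rge0 _ t0); lra.
Qed.

End ConvexMinimization.

(** * Contraction of one projected gradient step *)

Lemma obtuse_contraction (R : realType) (n : nat) (z w p q : 'rV[R]_n) :
  edot (z - p) (q - p) <= 0 -> edot (w - q) (p - q) <= 0 ->
  enorm (p - q) <= enorm (z - w).
Proof.
rewrite -(opprB p q) edotNr.
(* The residual difference has nonnegative inner product with [p - q], so adding it to [p - q]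
   cannot shorten that vector. *)
have -> : z - w = (p - q) + ((z - p) - (w - q)).
  by apply/rowP => i; rewrite !mxE; ring.
move: (p - q) (z - p) (w - q) => d a b ad bd; apply: enorm_le.
have : 0 <= edot (a - b) d by rewrite edotDl edotNl; lra.
move: (a - b) => c cd; have := edot_ge0 c.
by rewrite !edotE (edotC d c); lra.
Qed.

Lemma gradient_step_contraction (R : realType) (n : nat) (d D : 'rV[R]_n)
    (a m L : R) :
  0 <= a -> m * enorm d ^+ 2 <= edot D d -> enorm D <= L * enorm d ->
  enorm (d - a *: D) <=
    Num.sqrt (1 - 2 * a * m + a ^+ 2 * L ^+ 2) * enorm d.
Proof.
move=> a0 mD DL.
(* [Num.sqrt] is 0 on negative reals, so this holds for [q] of either sign. *)
have sqrt_normM q : Num.sqrt q * enorm d = Num.sqrt (enorm d ^+ 2 * q).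
  by rewrite sqrtrM ?sqr_ge0// sqrtr_sqr ger0_norm ?enorm_ge0// mulrC.
rewrite sqrt_normM; apply: ler_wsqrtr.
rewrite !edotE (edotC d D) -!enorm_sqr.
have : a ^+ 2 * enorm D ^+ 2 <= a ^+ 2 * (L ^+ 2 * enorm d ^+ 2).
  rewrite ler_wpM2l ?sqr_ge0// -exprMn ler_pXn2r ?nnegrE ?enorm_ge0//.
  exact: le_trans (enorm_ge0 D) DL.
have : a * (m * enorm d ^+ 2) <= a * edot D d by rewrite ler_wpM2l.
lra.
Qed.

(** * Vanishing contraction factor, affine recurrences and limits superior *)

Lemma contraction_factor_le0 (R : realFieldType) (mu L c a : R) :
  0 < mu -> 0 <= c -> mu <= L -> 0 < a ->
  1 - 2 * a * (mu - c) + a ^+ 2 * (L + c) ^+ 2 <= 0 ->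
  [/\ c = 0, L = mu & a * mu = 1].
Proof.
move=> mu0 c0 muL a0 q_le0.
(* Factoring [(L + c) ^+ 2 - (mu - c) ^+ 2] exhibits two nonnegative summands, which must both
   vanish. *)
have qE : 1 - 2 * a * (mu - c) + a ^+ 2 * (L + c) ^+ 2 =
    (1 - a * (mu - c)) ^+ 2 + a ^+ 2 * ((L - mu + 2 * c) * (L + mu)) by ring.
have sum_ge0 : 0 <= a ^+ 2 * ((L - mu + 2 * c) * (L + mu)).
  by rewrite mulr_ge0 ?sqr_ge0// mulr_ge0//; lra.
have sq_ge0 := sqr_ge0 (1 - a * (mu - c)).
have /eqP : (1 - a * (mu - c)) ^+ 2 = 0 by lra.
have /eqP : a ^+ 2 * ((L - mu + 2 * c) * (L + mu)) = 0 by lra.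
have Lmu : L + mu != 0 by rewrite gt_eqF//; lra.
rewrite mulf_eq0 sqrf_eq0 gt_eqF//= mulf_eq0 (negPf Lmu) orbF => /eqP Lc.
rewrite sqrf_eq0 => /eqP am.
have c_eq0 : c = 0 by lra.
by rewrite c_eq0 subr0 in am; split; lra.
Qed.

(** [c / (1 - r)] is the fixed point of the affine map, and any excess over it shrinks by the factor
    [r] at each step. *)
Lemma affine_recurrence_le (R : realFieldType) (u : nat -> R) (r c : R) :
  0 <= r < 1 -> 0 <= c -> (forall k, u k.+1 <= r * u k + c) ->
  forall k, u k <= u 0%N * r ^+ k + c / (1 - r).
Proof.
move=> /andP[r0 r1] c0 uS; have s0 : 0 < 1 - r by rewrite subr_gt0.
elim=> [|k IHk]; first by rewrite expr0 mulr1 lerDl divr_ge0// ltW.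
have h := ler_wpM2l r0 IHk.
have cE : c = (1 - r) * (c / (1 - r)) by rewrite mulrC divfK ?gt_eqF.
by have := uS k; rewrite exprS; move: (c / _) h cE => w h cE; lra.
Qed.

(** The geometric term is eventually below [e], so some tail supremum is at most [C + e]; the limit
    superior is the infimum of such suprema. *)
Lemma limn_esup_geometric_le (R : realType) (u : nat -> R) (K r C : R) :
  0 <= r < 1 -> (forall k, u k <= K * r ^+ k + C) ->
  (limn_esup (fun k => (u k)%:E) <= C%:E)%E.
Proof.
move=> /andP[r0 r1] uC; apply/lee_addgt0Pr => e e0.
have r_norm : `|r| < 1 by rewrite ger0_norm.
have [N _ ltN] := cvgr_lt (0 : R) (cvg_geometric K r_norm) _ e0.
apply: (@le_trans _ _ (ereal_sup [set (u k)%:E | k in [set k | (N <= k)%N]])).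
  by apply: ereal_inf_lbound; exists [set k | (N <= k)%N] => //; exists N.
apply: ge_ereal_sup => _ [k Nk <-]; rewrite -EFinD lee_fin addrC.
by apply: le_trans (uC k) _; rewrite lerD2r ltW//; exact: ltN.
Qed.

(** * Error bounds for the iteration with an approximate best response *)

Theorem theorem4 (R : realType) (n1 n2 : nat)
    (X1 : set 'rV[R]_n1) (X2 : set 'rV[R]_n2)
    (X1_neq0 : X1 !=set0) (X1_convex : convex_set X1) (X1_compact : compact X1)
    (X2_neq0 : X2 !=set0) (X2_convex : convex_set X2) (X2_compact : compact X2)
    (J1 J2 : 'rV[R]_n1 -> 'rV[R]_n2 -> R)
    (J1_continuous :
      {within X1 `*` X2,
        continuous (fun p : 'rV[R]_n1 * 'rV[R]_n2 => J1 p.1 p.2)})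
    (gradJ1 : 'rV[R]_n1 -> 'rV[R]_n2 -> 'rV[R]_n1)
    (br2 : 'rV[R]_n1 -> 'rV[R]_n2)
    (mu L12 L2 L1 : R)
    (mu_gt0 : 0 < mu) (L12_ge0 : 0 <= L12) (L2_ge0 : 0 <= L2)
    (* (i) *)
    (J1_differentiable : forall x1 x2, X1 x1 -> X2 x2 ->
      is_gradient X1 (fun y1 => J1 y1 x2) x1 (gradJ1 x1 x2))
    (J1_strongly_convex : forall x2, X2 x2 ->
      strongly_convex X1 mu (fun y1 => J1 y1 x2))
    (* (ii) *)
    (grad_lip2 : forall x1, X1 x1 -> elipschitz X2 L12 (gradJ1 x1))
    (* (iii) *)
    (BR2_single : forall x1, X1 x1 -> best_response X2 J2 x1 = [set br2 x1])
    (* (iv) *)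
    (br2_lip : elipschitz X1 L2 br2)
    (* (v) *)
    (J1_smooth : forall x2, X2 x2 ->
      elipschitz X1 L1 (fun y1 => gradJ1 y1 x2))
    (* (vi) *)
    (mu_gt : L12 * L2 < mu)
    (x1s : 'rV[R]_n1) (x2s : 'rV[R]_n2)
    (nash : nash_equilibrium X1 X2 J1 (best_response X2 J2) x1s x2s)
    (m := mu - L12 * L2) (LG := L1 + L12 * L2)
    (alpha : R) (alpha_range : 0 < alpha < 2 * m / LG ^+ 2)
    (eps : R) (eps_gt0 : 0 < eps)
    (hbr2 : 'rV[R]_n1 -> 'rV[R]_n2)
    (hbr2_X2 : forall x1, X1 x1 -> X2 (hbr2 x1))
    (hbr2_close : forall x1, X1 x1 -> enorm (hbr2 x1 - br2 x1) <= eps)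
    (x1 : nat -> 'rV[R]_n1) (x2 : nat -> 'rV[R]_n2)
    (x1_init : X1 (x1 0%N))
    (x2_step : forall k, x2 k = hbr2 (x1 k))
    (x1_step : forall k,
      x1 k.+1 = eproj X1 (x1 k - alpha *: gradJ1 (x1 k) (x2 k)))
    (rho := Num.sqrt (1 - 2 * alpha * m + alpha ^+ 2 * LG ^+ 2)) :
  (* rho in (0, 1); positivity fails only in the two degenerate cases listed *)
  [/\ 0 <= rho, rho < 1 &
      [\/ 0 < rho, is_subset1 X1 /\ L1 < mu |
          [/\ L12 * L2 = 0, L1 = mu & alpha * mu = 1]]] /\
  [/\ forall k, enorm (x1 k.+1 - x1s) <=
        rho * enorm (x1 k - x1s) + alpha * L12 * eps,
      (limn_esup (fun k => (enorm (x1 k - x1s))%:E) <=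
        (alpha * L12 / (1 - rho) * eps)%:E)%E,
      forall k, enorm (x2 k - x2s) <= L2 * enorm (x1 k - x1s) + eps &
      (limn_esup (fun k => (enorm (x2 k - x2s))%:E) <=
        ((L2 * (alpha * L12 / (1 - rho)) + 1) * eps)%:E)%E].
Proof.
have [X1s _ x1s_min] := nash; rewrite BR2_single// => x2sE.
have br2_X2 x : X1 x -> X2 (br2 x).
  move=> /BR2_single xE.
  by have [] : best_response X2 J2 x (br2 x) by rewrite xE.
have L12L2_ge0 : 0 <= L12 * L2 by rewrite mulr_ge0.
have grad_lip x y z : X1 x -> X1 y -> X1 z ->
    enorm (gradJ1 z (br2 x) - gradJ1 z (br2 y)) <= L12 * L2 * enorm (x - y).
  move=> Xx Xy Xz.
  apply: le_trans (grad_lip2 _ Xz _ _ (br2_X2 _ Xx) (br2_X2 _ Xy)) _.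
  by rewrite -mulrA ler_wpM2l// br2_lip.
pose G x := gradJ1 x (br2 x).
(* The first difference moves only Player 1's point, so (i) and (v) apply; the second moves only the
   response, so (ii) and (iv) apply. *)
have GB x y : G x - G y = (gradJ1 x (br2 x) - gradJ1 y (br2 x)) +
    (gradJ1 y (br2 x) - gradJ1 y (br2 y)) by rewrite addrA subrK.
have gradJ1_mono x y : X1 x -> X1 y ->
    mu * enorm (x - y) ^+ 2 <=
      edot (gradJ1 x (br2 x) - gradJ1 y (br2 x)) (x - y).
  move=> Xx Xy; have Xbx := br2_X2 _ Xx.
  have f_mu := J1_strongly_convex _ Xbx.
  by apply: (strongly_convex_monotone X1_convex mu_gt0 f_mu) => //;
    exact: J1_differentiable.
have G_mono x y : X1 x -> X1 y ->
    m * enorm (x - y) ^+ 2 <= edot (G x - G y) (x - y).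
  move=> Xx Xy; rewrite GB edotDl mulrBl lerD ?gradJ1_mono//.
  rewrite -[leRHS]opprK -edotNl lerN2 opprB expr2 mulrA.
  apply: le_trans (edot_le _ _) _; rewrite ler_wpM2r ?enorm_ge0// enormB.
  exact: grad_lip.
have G_lip x y : X1 x -> X1 y -> enorm (G x - G y) <= LG * enorm (x - y).
  move=> Xx Xy; rewrite GB mulrDl; apply: le_trans (enormD _ _) _.
  by rewrite lerD ?grad_lip//; apply: J1_smooth => //; exact: br2_X2.
have [a0 a_lt] := andP alpha_range.
(* Division by zero yields 0, so [LG = 0] would leave no admissible [alpha]. *)
have LG2_gt0 : 0 < LG ^+ 2.
  rewrite lt_neqAle sqr_ge0 andbT eq_sym; apply/eqP => LG0.
  by move: (lt_trans a0 a_lt); rewrite LG0 invr0 mulr0 ltxx.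
have rho_lt1 : rho < 1.
  rewrite -sqrtr1 ltr_sqrt//.
  by move: a_lt; rewrite ltr_pdivlMr// -(ltr_pM2l a0); lra.
have rho_ge0 : 0 <= rho := sqrtr_ge0 _.
have s_gt0 : 0 < 1 - rho by rewrite subr_gt0.
have x1_X1 k : X1 (x1 k) by elim: k => // k _; rewrite x1_step; exact: eproj_in.
have x2_X2 k : X2 (x2 k) by rewrite x2_step; exact: hbr2_X2.
have x2sX : X2 x2s by rewrite x2sE; exact: br2_X2.
(* Since [x2s = br2 x1s], [G x1s] is the gradient at [x1s] of the function that [x1s] minimizes. *)
have VI y : X1 y -> 0 <= edot (G x1s) (y - x1s).
  move=> Xy; rewrite /G -x2sE.
  exact: (argmin_edot_ge0 X1_convex (J1_differentiable _ _ X1s x2sX) x1s_min).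
have x1_le k : enorm (x1 k.+1 - x1s) <=
    rho * enorm (x1 k - x1s) + alpha * L12 * eps.
  pose g := gradJ1 (x1 k) (x2 k).
  have contr : enorm (x1 k.+1 - x1s) <=
      enorm ((x1 k - alpha *: g) - (x1s - alpha *: G x1s)).
    apply: obtuse_contraction; first by rewrite x1_step; exact: eproj_obtuse.
    (* Here [x1s] plays the projection of [x1s - alpha *: G x1s]; its obtuse-angle condition is [VI]
       scaled by [- alpha]. *)
    by rewrite addrAC subrr sub0r edotNl edotZl oppr_le0 mulr_ge0 ?VI// ltW.
  apply: le_trans contr _.
  have -> : (x1 k - alpha *: g) - (x1s - alpha *: G x1s) =
      ((x1 k - x1s) - alpha *: (G (x1 k) - G x1s)) + alpha *: (G (x1 k) - g).
    by apply/rowP => i; rewrite !mxE; ring.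
  apply: le_trans (enormD _ _) _; apply: lerD.
    apply: gradient_step_contraction; first exact: ltW.
      exact: G_mono.
    exact: G_lip.
  rewrite enormZ ?(ltW a0)// -mulrA ler_pM2l//.
  apply: le_trans (grad_lip2 _ (x1_X1 k) _ _ (br2_X2 _ (x1_X1 k)) (x2_X2 k)) _.
  by rewrite ler_wpM2l// enormB x2_step hbr2_close.
have x2_le k : enorm (x2 k - x2s) <= L2 * enorm (x1 k - x1s) + eps.
  have -> : x2 k - x2s = (br2 (x1 k) - br2 x1s) + (hbr2 (x1 k) - br2 (x1 k)).
    by rewrite x2sE x2_step [RHS]addrC addrA subrK.
  apply: le_trans (enormD _ _) _.
  by rewrite lerD ?br2_lip ?hbr2_close.
have c_ge0 : 0 <= alpha * L12 * eps by rewrite !mulr_ge0// ltW.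
have rho01 : 0 <= rho < 1 by rewrite rho_ge0.
have x1_geom := affine_recurrence_le rho01 c_ge0 x1_le.
split; last split => //.
- split => //.
  (* Monotonicity and smoothness give [mu * d ^ 2 <= L1 * d ^ 2] for points at distance [d]; hence
     [L1 < mu] leaves at most one point in [X1]. *)
  have [L1_lt|L1_ge] := ltP L1 mu.
    apply: Or32; split => // x y Xx Xy; apply/eqP; rewrite -subr_eq0 -enorm_eq0.
    apply: contraTT L1_lt => d0; rewrite -leNgt.
    have {}d0 : 0 < enorm (x - y) by rewrite lt_neqAle eq_sym d0 enorm_ge0.
    rewrite -(ler_pM2r d0) -(ler_pM2r d0) -mulrA -expr2.
    apply: le_trans (gradJ1_mono _ _ Xx Xy) _; apply: le_trans (edot_le _ _) _.
    by rewrite ler_pM2r//; apply: J1_smooth => //; exact: br2_X2.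
  (* A zero square root only says that the radicand is nonpositive, which is what
     [contraction_factor_le0] takes as input. *)
  have := rho_ge0; rewrite le_eqVlt => /orP[/eqP rho0|]; last exact: Or31.
  apply/Or33/contraction_factor_le0 => //.
  by rewrite -sqrtr_eq0; apply/eqP/esym.
- apply: limn_esup_geometric_le rho01 _ => k.
  by rewrite mulrAC; exact: x1_geom.
(* The geometric majorant of the first player's error is scaled by [L2]; [eps] joins the constant
   term. *)
- apply: (limn_esup_geometric_le (K := L2 * enorm (x1 0%N - x1s)) rho01) => k.
  apply: le_trans (x2_le k) _.
  rewrite mulrDl mul1r addrA lerD2r.
  rewrite [leRHS](_ : _ = L2 * (enorm (x1 0%N - x1s) * rho ^+ k +
    alpha * L12 * eps / (1 - rho))); last by ring.
  exact: ler_wpM2l (x1_geom k).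
Qed.
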